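(* For every fixed integer $b\ge 2$, as $n\to\infty$, $$(\tilde C_2(n),\tilde C_3(n),\dots,\tilde C_b(n))\Rightarrow(\tilde Z_2,\tilde Z_3,\dots,\tilde Z_b)$$ in distribution, where $\tilde Z_2,\tilde Z_3,\dots$ are independent Poisson random variables with means $\mathbb{E}\tilde Z_j=\tilde\lambda_j=\frac1j\,\mathbb{P}(\mathrm{Po}(j)<j-1)$.
   Context: Write $[n]=\{1,\dots,n\}$. For $n\ge 2$, the screaming toes mapping of size $n$ is the random mapping $f:[n]\to[n]$, $f(i)=B_i$, where $B_1,\dots,B_n$ are independent and $\mathbb{P}(B_i=j)=1/(n-1)$ for $j\in[n]\setminus\{i\}$; equivalently, $f$ is uniform over the $(n-1)^n$ mappings with no fixed points. Two elements $i,j$ are in the same component of a mapping if some iterate of $i$ equals some iterate of $j$ (iterates $f^k$, $k\ge 0$); the size of a component is its number of elements. $\tilde C_j(n)$ is the number of components of size $j$. $\mathrm{Po}(\mu)$ denotes a Poisson random variable with mean $\mu$. *)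

(* Defs.v *)
From HB Require Import structures.
From mathcomp Require Import all_boot all_order all_algebra finmap.
From mathcomp Require Import all_classical all_reals all_analysis.
Set Implicit Arguments.
Unset Strict Implicit.
Unset Printing Implicit Defensive.
Import Order.TTheory GRing.Theory Num.Theory.
Import numFieldNormedType.Exports.
Local Open Scope classical_set_scope.
Local Open Scope ring_scope.

(* Mutual independence of the variables [X i], [i] in [A], with respect to the
   sigma-algebra [G] on their common codomain: the product rule over every
   finite subfamily. *)
Definition mutually_independent (R : realType) (d : measure_display)
    (Omega : measurableType d) (P : probability Omega R)
    (I : choiceType) (A : set I) (U : Type) (G : set (set U))
    (X : I -> Omega -> U) : Prop :=
  forall (S : {fset I}) (E : I -> set U),
    [set` S] `<=` A -> (forall i, i \in S -> G (E i)) ->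
    P (\bigcap_(i in [set` S]) (X i @^-1` E i)) =
      (\prod_(i <- S) P (X i @^-1` E i))%E.

(* Weak convergence of the laws. The [n]-th variable may live on its own
   probability space. Measurability of [X n] and [Y] is left to the user of
   the definition; here they are functions of finitely many discrete random
   variables. *)
Definition cvg_in_distribution (R : realType) (U : topologicalType)
    (dn : nat -> measure_display) (Omegan : forall n, measurableType (dn n))
    (Pn : forall n, probability (Omegan n) R) (X : forall n, Omegan n -> U)
    (d : measure_display) (Omega : measurableType d)
    (P : probability Omega R) (Y : Omega -> U) : Prop :=
  forall g : U -> R, continuous g -> bounded_fun g ->
    'E_(Pn n)[g \o X n]%E @[n --> \oo] --> 'E_P[g \o Y]%E.

(* [B] is, for n >= 2, the screaming toes mapping of size n, with [n] encoded
   as 'I_n; the point probabilities sum to 1, so that B_i <> i almost surely. *)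
Definition screaming_toes (R : realType) (n : nat) (d : measure_display)
    (Omega : measurableType d) (P : probability Omega R)
    (B : 'I_n -> Omega -> 'I_n) : Prop :=
  [/\ forall i (E : set 'I_n), measurable (B i @^-1` E),
      mutually_independent P setT discrete_measurable B
    & forall i j : 'I_n, j != i ->
        P [set w | B i w = j] = ((n - 1)%N%:R^-1)%:E].

Definition same_component (T : finType) (f : T -> T) : rel T :=
  fun x y => `[< exists k l : nat, iter k f x = iter l f y >].

Definition components (T : finType) (f : T -> T) : {set {set T}} :=
  equivalence_partition (same_component f) [set: T]%SET.

Definition ncomponents (T : finType) (f : T -> T) (j : nat) : nat :=
  #|[set C in components f | #|C| == j]%SET|.

(* The second argument of [poisson_prob] is a dummy. *)
Definition poisson_law (R : realType) (mu : R) : set nat -> \bar R :=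
  poisson_prob mu 0.

(* (1 / j) P(Po(j) < j - 1); the subtraction is only used for j >= 2. *)
Definition lambda_tilde (R : realType) (j : nat) : R :=
  j%:R^-1 * fine (poisson_law (j%:R : R) [set k | (k < j - 1)%N]).

(* Main.v *)
Require Import Defs.
From HB Require Import structures.
From mathcomp Require Import all_boot all_order all_algebra finmap.
From mathcomp Require Import all_classical all_reals all_analysis.
From mathcomp Require Import measurable_realfun ring lra zify.
Set Implicit Arguments.
Unset Strict Implicit.
Unset Printing Implicit Defensive.
Import Order.TTheory GRing.Theory Num.Theory.
Import numFieldNormedType.Exports.

(* Removing a component of size j from a fixed-point-free map on [n] leaves a
   fixed-point-free map on n - j points, so for every functional Phi of the
   component counts C,
     sum_f C_j Phi(C) = binom(n, j) t_j sum_f' Phi(C' + e_j),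
   where f, f' range over the fixed-point-free maps on n and n - j points and
   t_j counts the connected ones on j points.  Everything follows from this.
   - With Phi = 1 and sum_j j C_j = n it is a recursion determining t_j, which
     Abel's identity solves: t_j = (j-1)! sum_(k < j-1) j^k / k!.
   - Hence E C_j tends to t_j e^(-j) / j!, which is lambda_tilde_j.
   - With Phi a binomial coefficient of the number S of components of sizes
     2, ..., b it gives E binom(S, k) -> Lambda^k / k!, with Lambda the sum of
     the lambda_tilde_j, so P(S = 0) -> e^(-Lambda) by the Bonferroni
     inequalities.
   - With Phi an indicator it reads
     m_j P_n(C = m) = E_n(C_j) P_(n-j)(C = m - e_j), which carries the limit
     from m = 0 to all m.
   Convergence of the point masses to a probability gives convergence in
   distribution. *)

(** * Components of a map and counting of fixed-point-free maps *)

Section Components.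
Local Open Scope set_scope.

Definition component (T : finType) (f : T -> T) (x : T) : {set T} :=
  [set y | same_component f x y].

Lemma same_componentP (T : finType) (f : T -> T) x y :
  reflect (exists k l, iter k f x = iter l f y) (same_component f x y).
Proof. exact: asboolP. Qed.

Lemma same_component_refl (T : finType) (f : T -> T) : reflexive (same_component f).
Proof. by move=> x; apply/same_componentP; exists 0, 0. Qed.

Lemma same_component_sym (T : finType) (f : T -> T) : symmetric (same_component f).
Proof.
by move=> x y; apply/same_componentP/same_componentP => -[k [l e]]; exists l, k.
Qed.

Lemma same_component_trans (T : finType) (f : T -> T) : transitive (same_component f).
Proof.
move=> y x z /same_componentP[k [l e]] /same_componentP[k' [l' e']].
apply/same_componentP; exists (k' + k), (l + l').
by rewrite iterD e -iterD addnC iterD e' -iterD.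
Qed.

Lemma same_component_step (T : finType) (f : T -> T) x : same_component f x (f x).
Proof. by apply/same_componentP; exists 1, 0. Qed.

Lemma same_component_stepr (T : finType) (f : T -> T) x y :
  same_component f x (f y) = same_component f x y.
Proof.
apply/idP/idP => h; apply: (same_component_trans h); last exact: same_component_step.
by rewrite same_component_sym same_component_step.
Qed.

Lemma eq_component (T : finType) (f : T -> T) x y :
  same_component f x y -> component f x = component f y.
Proof.
move=> h; apply/setP => z; rewrite !inE; apply/idP/idP; last exact: same_component_trans h.
by apply: same_component_trans; rewrite same_component_sym.
Qed.

Lemma components_imset (T : finType) (f : T -> T) :
  components f = [set component f x | x in [set: T]].
Proof.
rewrite /components /equivalence_partition; apply: eq_imset => x.
by apply/setP => y; rewrite !inE.
Qed.

Lemma sum_ncomponents (T : finType) (f : T -> T) :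
  (\sum_(j < #|T|.+1) j * ncomponents f j)%N = #|T|.
Proof.
have eqR : {in [set: T] & &, equivalence_rel (same_component f)}.
  move=> x y z _ _ _; split; first exact: same_component_refl.
  move=> xy; apply/idP/idP; last exact: same_component_trans.
  by apply: same_component_trans; rewrite same_component_sym.
have := card_partition (equivalence_partitionP eqR).
rewrite cardsT => cT; rewrite [RHS]cT.
(* Grouping by size needs a finite index type; [inord] loses nothing since no component exceeds
   [#|T|]. *)
rewrite [RHS](partition_big (fun C : {set T} => inord #|C| : 'I_#|T|.+1) xpredT) //=.
apply: eq_bigr => j _; rewrite /ncomponents -[X in (_ * X)%N]sum1_card big_distrr /=.
rewrite [RHS](eq_bigr (fun=> j * 1)%N); last first.
  move=> C /andP[_ /eqP <-]; rewrite muln1 inordK //.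
  by rewrite ltnS max_card.
apply: eq_bigl => C; rewrite !inE; congr (_ && _).
by rewrite -val_eqE /= inordK // ltnS max_card.
Qed.

End Components.

(** * Transport of maps along bijections, and disjoint unions of maps *)

Section Glue.
Local Open Scope set_scope.

Definition fpf (T : finType) : {set {ffun T -> T}} :=
  [set f : {ffun T -> T} | [forall x, f x != x]].

Definition conjf (T T' : finType) (h : T -> T') (k : T' -> T)
    (f : {ffun T -> T}) : {ffun T' -> T'} := [ffun x => h (f (k x))].

Lemma component_conjf (T T' : finType) (h : T -> T') (k : T' -> T)
    (hK : cancel h k) (kK : cancel k h) (f : {ffun T -> T}) x :
  component (conjf h k f) (h x) = h @: component f x.
Proof.
have itE n y : iter n (conjf h k f) (h y) = h (iter n f y).
  by elim: n => //= n ->; rewrite ffunE hK.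
apply/setP => y; rewrite -[y]kK (mem_imset _ _ (can_inj hK)) !inE.
apply/same_componentP/same_componentP => -[m [n]].
  by rewrite !itE => /(can_inj hK) e; exists m, n.
by move=> e; exists m, n; rewrite !itE e.
Qed.

Lemma components_conjf (T T' : finType) (h : T -> T') (k : T' -> T)
    (hK : cancel h k) (kK : cancel k h) (f : {ffun T -> T}) :
  components (conjf h k f) = [set h @: (C : {set T}) | C in components f].
Proof.
rewrite !components_imset; apply/setP => C; apply/imsetP/imsetP.
  move=> [y _ ->]; exists (component f (k y)); first exact: imset_f.
  by rewrite -(component_conjf hK kK) kK.
move=> [_ /imsetP[x _ ->] ->]; exists (h x) => //.
by rewrite (component_conjf hK kK).
Qed.

Lemma ncomponents_conjf (T T' : finType) (h : T -> T') (k : T' -> T)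
    (hK : cancel h k) (kK : cancel k h) (f : {ffun T -> T}) j :
  ncomponents (conjf h k f) j = ncomponents f j.
Proof.
rewrite /ncomponents (components_conjf hK kK).
rewrite -(card_imset _ (imset_inj (can_inj hK))); apply: eq_card => C.
rewrite inE; apply/andP/imsetP.
  move=> [/imsetP[D Dc ->]]; rewrite (card_imset _ (can_inj hK)) => cD.
  by exists D => //; rewrite inE Dc.
move=> [D]; rewrite inE => /andP[Dc cD] ->.
by rewrite (card_imset _ (can_inj hK)) imset_f.
Qed.

Lemma fpf_conjf (T T' : finType) (h : T -> T') (k : T' -> T)
    (hK : cancel h k) (kK : cancel k h) (f : {ffun T -> T}) :
  (conjf h k f \in fpf T') = (f \in fpf T).
Proof.
rewrite !inE; apply/forallP/forallP => [H x|H y].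
  by have := H (h x); rewrite ffunE hK (inj_eq (can_inj hK)).
by rewrite ffunE -[X in _ != X]kK (inj_eq (can_inj hK)).
Qed.

Definition ffun_sum (T1 T2 : finType) (f1 : {ffun T1 -> T1}) (f2 : {ffun T2 -> T2}) :
    {ffun T1 + T2 -> T1 + T2} :=
  [ffun s => match s with inl a => inl (f1 a) | inr b => inr (f2 b) end].

Lemma iter_ffun_sum_inl (T1 T2 : finType) (f1 : {ffun T1 -> T1}) (f2 : {ffun T2 -> T2}) n a :
  iter n (ffun_sum f1 f2) (inl a) = inl (iter n f1 a).
Proof. by elim: n => //= n ->; rewrite ffunE. Qed.

Lemma iter_ffun_sum_inr (T1 T2 : finType) (f1 : {ffun T1 -> T1}) (f2 : {ffun T2 -> T2}) n a :
  iter n (ffun_sum f1 f2) (inr a) = inr (iter n f2 a).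
Proof. by elim: n => //= n ->; rewrite ffunE. Qed.

Lemma component_ffun_sum_inl (T1 T2 : finType) (f1 : {ffun T1 -> T1}) (f2 : {ffun T2 -> T2}) a :
  component (ffun_sum f1 f2) (inl a) = inl @: component f1 a.
Proof.
apply/setP => s; rewrite inE; apply/same_componentP/imsetP.
  case: s => b [m [n]]; rewrite !(iter_ffun_sum_inl,iter_ffun_sum_inr) // => -[e].
  by exists b => //; rewrite inE; apply/same_componentP; exists m, n.
move=> [b]; rewrite inE => /same_componentP[m [n e]] ->; exists m, n.
by rewrite !iter_ffun_sum_inl e.
Qed.

Lemma component_ffun_sum_inr (T1 T2 : finType) (f1 : {ffun T1 -> T1}) (f2 : {ffun T2 -> T2}) a :
  component (ffun_sum f1 f2) (inr a) = inr @: component f2 a.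
Proof.
apply/setP => s; rewrite inE; apply/same_componentP/imsetP.
  case: s => b [m [n]]; rewrite !(iter_ffun_sum_inl,iter_ffun_sum_inr) // => -[e].
  by exists b => //; rewrite inE; apply/same_componentP; exists m, n.
move=> [b]; rewrite inE => /same_componentP[m [n e]] ->; exists m, n.
by rewrite !iter_ffun_sum_inr e.
Qed.

Lemma component_self (T : finType) (f : T -> T) x : x \in component f x.
Proof. by rewrite inE same_component_refl. Qed.

Lemma components_ffun_sum (T1 T2 : finType) (f1 : {ffun T1 -> T1}) (f2 : {ffun T2 -> T2}) :
  components (ffun_sum f1 f2) =
  [set inl @: (C : {set T1}) | C in components f1] :|:
  [set inr @: (C : {set T2}) | C in components f2].
Proof.
rewrite !components_imset; apply/setP => C; rewrite inE; apply/imsetP/orP.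
  move=> [[a|a] _ ->]; [left|right].
    by rewrite component_ffun_sum_inl; do 2 apply: imset_f.
  by rewrite component_ffun_sum_inr; do 2 apply: imset_f.
case=> /imsetP[_ /imsetP[a _ ->] ->]; [exists (inl a)|exists (inr a)] => //.
  by rewrite component_ffun_sum_inl.
by rewrite component_ffun_sum_inr.
Qed.

Lemma ncomponents_ffun_sum (T1 T2 : finType) (f1 : {ffun T1 -> T1}) (f2 : {ffun T2 -> T2}) j :
  ncomponents (ffun_sum f1 f2) j = (ncomponents f1 j + ncomponents f2 j)%N.
Proof.
rewrite /ncomponents components_ffun_sum.
set P1 := [set C in components f1 | _]; set P2 := [set C in components f2 | _].
rewrite -(card_imset P1 (imset_inj (@inl_inj T1 T2))).
rewrite -(card_imset P2 (imset_inj (@inr_inj T1 T2))).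
rewrite -cardsUI.
(* Since components are nonempty, an image under [inl] and an image under [inr] never coincide, so
   the two counts add up. *)
have -> : [set inl @: (x : {set T1}) | x in P1] :&: [set inr @: (x : {set T2}) | x in P2] =
  finset.set0.
  apply/setP => C; rewrite !inE; apply/negP => /andP[/imsetP[D DP ->]].
  move=> /imsetP[E _ DE]; move: DP; rewrite inE components_imset => /andP[/imsetP[a _ Da] _].
  have /(imset_f (@inl T1 T2)) : a \in D by rewrite Da component_self.
  by rewrite DE => /imsetP[].
rewrite cards0 addn0; apply: eq_card => C; rewrite !inE.
apply/andP/orP.
  move=> [/orP[]/imsetP[D Dc ->]]; [left|right]; apply/imsetP; exists D => //; rewrite inE Dc.
    by rewrite -(card_imset _ (@inl_inj T1 T2)).
  by rewrite -(card_imset _ (@inr_inj T1 T2)).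
by case=> /imsetP[D]; rewrite inE => /andP[Dc cD] ->;
  rewrite (card_imset _ (@inl_inj _ _), card_imset _ (@inr_inj _ _)) cD imset_f ?orbT.
Qed.

Lemma fpf_ffun_sum (T1 T2 : finType) (f1 : {ffun T1 -> T1}) (f2 : {ffun T2 -> T2}) :
  (ffun_sum f1 f2 \in fpf _) = (f1 \in fpf T1) && (f2 \in fpf T2).
Proof.
rewrite !inE; apply/forallP/andP => [H|[/forallP H1 /forallP H2] [a|a]]; last 2 first.
- by rewrite ffunE (inj_eq (@inl_inj _ _)).
- by rewrite ffunE (inj_eq (@inr_inj _ _)).
by split; apply/forallP => a; [have := H (inl a)|have := H (inr a)];
  rewrite ffunE ?(inj_eq (@inl_inj _ _)) ?(inj_eq (@inr_inj _ _)).
Qed.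

Lemma inl_in_components_ffun_sum (T1 T2 : finType) (f1 : {ffun T1 -> T1}) (f2 : {ffun T2 -> T2}) :
  ((inl @: [set: T1] : {set T1 + T2}) \in components (ffun_sum f1 f2)) =
  ([set: T1] \in components f1).
Proof.
rewrite components_ffun_sum inE (mem_imset _ _ (imset_inj (@inl_inj T1 T2))) orbC.
case: imsetP => //= -[D]; rewrite components_imset => /imsetP[b _ Db] /setP/(_ (inr b)).
by rewrite (mem_imset _ _ (@inr_inj _ _)) Db component_self => /imsetP[].
Qed.

Definition connected_map (T : finType) (f : T -> T) : bool :=
  [set: T] \in components f.

Lemma ncomponents_connected (T : finType) (f : T -> T) j :
  connected_map f -> ncomponents f j = (j == #|T|) :> nat.
Proof.
rewrite /connected_map /ncomponents components_imset => /imsetP[a _ aT].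
have cE x : component f x = [set: T].
  rewrite [RHS]aT; apply/esym/eq_component; have : x \in [set: T] by rewrite inE.
  by rewrite aT inE.
have -> : [set component f x | x in [set: T]] = [set [set: T]].
  apply/setP => C; rewrite inE; apply/imsetP/eqP => [[x _ ->]|->] //.
  by exists a.
case: eqP => [->|jT].
  rewrite [RHS]/= -(cards1 [set: T]); apply: eq_card => C; rewrite !inE andbC.
  by case: (C =P [set: T]) => [->|]; rewrite ?andbF // cardsT eqxx.
apply/eqP; rewrite cards_eq0; apply/eqP/setP => C; rewrite !inE.
by apply/negP => /andP[/eqP -> /eqP]; rewrite cardsT => /esym.
Qed.

(** The branch [else a] is a default: it is not reached when the left summand is a component of
    [f]. *)
Definition restrl (T1 T2 : finType) (f : {ffun T1 + T2 -> T1 + T2}) : {ffun T1 -> T1} :=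
  [ffun a => if f (inl a) is inl b then b else a].

Definition restrr (T1 T2 : finType) (f : {ffun T1 + T2 -> T1 + T2}) : {ffun T2 -> T2} :=
  [ffun a => if f (inr a) is inr b then b else a].

Lemma ffun_sumKl (T1 T2 : finType) (f1 : {ffun T1 -> T1}) (f2 : {ffun T2 -> T2}) :
  restrl (ffun_sum f1 f2) = f1.
Proof. by apply/ffunP => a; rewrite !ffunE. Qed.

Lemma ffun_sumKr (T1 T2 : finType) (f1 : {ffun T1 -> T1}) (f2 : {ffun T2 -> T2}) :
  restrr (ffun_sum f1 f2) = f2.
Proof. by apply/ffunP => a; rewrite !ffunE. Qed.

(** A point and its image lie in the same component, so [f] preserves both the left summand and its
    complement and splits over them. *)
Lemma ffun_sum_restr (T1 T2 : finType) (f : {ffun T1 + T2 -> T1 + T2}) :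
  (inl @: [set: T1] : {set T1 + T2}) \in components f ->
  ffun_sum (restrl f) (restrr f) = f.
Proof.
rewrite components_imset => /imsetP[s _ sE].
have st x : (f x \in inl @: [set: T1]) = (x \in inl @: [set: T1]).
  by rewrite sE !inE same_component_stepr.
apply/ffunP => -[a|a]; rewrite !ffunE.
  have := st (inl a); rewrite (mem_imset _ _ (@inl_inj _ _)) inE.
  by case/imsetP => b _ ->.
by have := st (inr a); case: (f (inr a)) => // b; rewrite (mem_imset _ _ (@inl_inj _ _)) inE
  => /esym/imsetP[].
Qed.

End Glue.

(** * Removal of one component and the resulting recursion *)

Section Recursion.
Local Open Scope set_scope.
Local Open Scope ring_scope.

Definition nconnected (j : nat) : nat :=
  #|[set f in fpf 'I_j | connected_map f]|.

(** [Phi] sees only the function of component counts, not the map, so that the same kind of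
    functional applies to ground sets of every size. *)
Definition sum_fpf (R : nmodType) (n : nat) (Phi : (nat -> nat) -> R) : R :=
  \sum_(f in fpf 'I_n) Phi (ncomponents f).

(** A map with component [K] is the disjoint union of a connected map on [K] and an arbitrary map on
    the complement. The first part contributes exactly one component, of size [#|K|], whichever
    connected map it is. *)
Lemma sum_fpf_component (R : pzSemiRingType) (T : finType) (K : {set T})
    (Phi : (nat -> nat) -> R) :
  \sum_(f in fpf T | K \in components f) Phi (ncomponents f) =
  (nconnected #|K|)%:R *
  sum_fpf #|~: K| (fun c => Phi (fun i => (c i + (i == #|K|))%N)).
Proof.
pose T1 := 'I_#|K|; pose T2 := 'I_#|~: K|.
pose h (s : T1 + T2) : T := match s with inl a => enum_val a | inr b => enum_val b end.
have h_inj : injective h.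
  move=> [a|a] [b|b] /= e.
  - by rewrite (enum_val_inj e).
  - by have := enum_valP b; rewrite -e inE enum_valP.
  - by have := enum_valP a; rewrite e inE enum_valP.
  - by rewrite (enum_val_inj e).
have [k hK kK] : bijective h.
  by apply: inj_card_bij => //; rewrite card_sum !card_ord cardsC.
have hT1 : h @: (inl @: [set: T1] : {set T1 + T2}) = K.
  apply/setP => x; apply/imsetP/idP.
    by move=> [_ /imsetP[a _ ->] ->] /=; exact: enum_valP.
  move=> xK; exists (inl (enum_rank_in xK x)); first by rewrite imset_f.
  by rewrite /= enum_rankK_in.
have kconj (f : {ffun T -> T}) : conjf h k (conjf k h f) = f.
  by apply/ffunP => x; rewrite !ffunE !kK.
have kconj' (f : {ffun (T1 + T2) -> (T1 + T2)}) : conjf k h (conjf h k f) = f.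
  by apply/ffunP => x; rewrite !ffunE !hK.
rewrite (reindex (conjf h k)) /=; last first.
  by exists (conjf k h) => f _; [exact: kconj'|exact: kconj].
rewrite (eq_big (fun f : {ffun (T1 + T2) -> (T1 + T2)} => (f \in fpf _) &&
    ((inl @: [set: T1] : {set T1 + T2}) \in components f))
  (fun f => Phi (ncomponents f))); first last.
- by move=> f _; congr Phi; apply/funext => j; rewrite (ncomponents_conjf hK kK).
- move=> f; rewrite (fpf_conjf hK kK) (components_conjf hK kK); congr (_ && _).
  by rewrite -[X in (X \in _) = _]hT1 (mem_imset _ _ (imset_inj h_inj)).
(* On maps having the left summand as a component, gluing is inverted by the pair of
   restrictions. *)
rewrite (reindex_onto (fun p : {ffun T1 -> T1} * {ffun T2 -> T2} => ffun_sum p.1 p.2)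
  (fun f => (restrl f, restrr f))) /=; last first.
  by move=> f /andP[_]; exact: ffun_sum_restr.
rewrite (eq_big (fun p : {ffun T1 -> T1} * {ffun T2 -> T2} =>
  (p.1 \in [set f in fpf T1 | connected_map f]) && (p.2 \in fpf T2))
  (fun p => Phi (fun i => (ncomponents p.2 i + (i == #|K|))%N))); first last.
- move=> [f1 f2] /= /andP[/andP[_]]; rewrite inl_in_components_ffun_sum => cf1 _.
  congr Phi; apply/funext => j; rewrite ncomponents_ffun_sum addnC.
  by rewrite (ncomponents_connected _ cf1) card_ord.
- move=> [f1 f2] /=; rewrite ffun_sumKl ffun_sumKr eqxx andbT inl_in_components_ffun_sum.
  by rewrite fpf_ffun_sum [in RHS]inE -!andbA; congr (_ && _); rewrite andbC.
rewrite -(pair_big_dep (mem [set f in fpf T1 | connected_map f]) (fun _ => mem (fpf T2))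
  (fun f1 f2 => Phi (fun i => (ncomponents f2 i + (i == #|K|))%N))) /=.
by rewrite sumr_const -/T1 /nconnected mulr_natl.
Qed.

(** Double counting of pairs of a map and one of its components [K] of size [j]: each of the
    ['C(n, j)] possible sets [K] contributes the same amount. *)
Lemma sum_fpf_ncomponents (R : pzSemiRingType) (n j : nat) (Phi : (nat -> nat) -> R) :
  sum_fpf n (fun c => (c j)%:R * Phi c) =
  ('C(n, j) * nconnected j)%:R *
  sum_fpf (n - j) (fun c => Phi (fun i => (c i + (i == j))%N)).
Proof.
rewrite /sum_fpf (eq_bigr (fun f : {ffun 'I_n -> 'I_n} => \sum_(K : {set 'I_n} | (#|K| == j)
  && (K \in components f)) Phi (ncomponents f))); last first.
  move=> f _; rewrite sumr_const mulr_natl; congr (_ *+ _).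
  by apply: eq_card => K; rewrite !inE andbC.
rewrite (exchange_big_dep (fun K : {set 'I_n} => #|K| == j)) /=; last first.
  by move=> f K _ /andP[].
rewrite (eq_bigr (fun K : {set 'I_n} => (nconnected j)%:R *
  sum_fpf (n - j) (fun c => Phi (fun i => (c i + (i == j))%N)))); last first.
  move=> K /eqP <-.
  have -> : (n - #|K|)%N = #|~: K| by rewrite [RHS]cardsCs finset.setCK card_ord.
  by rewrite -sum_fpf_component; apply: eq_bigl => f; rewrite eqxx.
rewrite sumr_const natrM -mulrA [RHS]mulr_natl; congr (_ *+ _).
rewrite -[in RHS](card_ord n) -card_draws.
by apply: eq_card => K; rewrite inE.
Qed.

Lemma card_fpf n : #|fpf 'I_n| = ((n - 1) ^ n)%N.
Proof.
have -> : #|fpf 'I_n| = #|family (fun x : 'I_n => predC1 x)|.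
  apply: eq_card => f; rewrite inE; apply/forallP/familyP => H x; have := H x; by rewrite !inE.
rewrite card_family foldrE big_map big_enum /=.
rewrite (eq_bigr (fun=> (n - 1)%N)); last by move=> x _; rewrite cardC1 card_ord subn1.
by rewrite prod_nat_const card_ord.
Qed.

End Recursion.

(** * Abel's identity and the number of connected maps *)

Section Abel.
Local Open Scope ring_scope.

Lemma sum_ord_widen0 (R : nmodType) (F : nat -> R) (n m : nat) : (n <= m)%N ->
  (forall i, (n <= i < m)%N -> F i = 0) -> \sum_(i < n) F i = \sum_(i < m) F i.
Proof.
move=> nm F0; rewrite (big_ord_widen _ F nm) big_mkcond; apply: eq_bigr => i _.
by case: ltnP => // ni; rewrite F0 // ni ltn_ord.
Qed.

(** Induction on [d], splitting one factor [x + i]: the part with [x] is a difference of lower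
    degree, and the part with [i] becomes, by absorption of [i] into the binomial coefficient, a
    difference of order [M - 1] at [x + 1]. *)
Lemma finite_difference_pow (R : comPzRingType) (M d : nat) (x : R) : (d <= M)%N ->
  \sum_(i < M.+1) (-1) ^+ (M - i) * 'C(M, i)%:R * (x + i%:R) ^+ d =
  ((d == M) * M`!)%:R.
Proof.
elim: d M x => [|d IH] M x dM.
  transitivity ((-1 + 1 : R) ^+ M).
    rewrite exprDn; apply: eq_bigr => i _.
    by rewrite expr0 expr1n !mulr1 mulr_natr.
  rewrite addNr; case: M {dM} => [|M]; first by rewrite expr0.
  by rewrite expr0n.
case: M dM => // M dM.
transitivity (x * \sum_(i < M.+2) (-1) ^+ (M.+1 - i) * 'C(M.+1, i)%:R * (x + i%:R) ^+ d +
  M.+1%:R * \sum_(i < M.+1) (-1) ^+ (M - i) * 'C(M, i)%:R * ((x + 1) + i%:R) ^+ d).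
  rewrite (eq_bigr (fun i : 'I_M.+2 => x * ((-1) ^+ (M.+1 - i) * 'C(M.+1, i)%:R * (x + i%:R) ^+ d)
    + (-1) ^+ (M.+1 - i) * (i * 'C(M.+1, i))%:R * (x + i%:R) ^+ d)); last first.
    move=> i _; rewrite exprS natrM.
    by set a := (-1) ^+ _; set p := (x + _) ^+ d; ring.
  rewrite big_split /= -mulr_sumr; congr (_ + _).
  rewrite big_ord_recl mul0n mulr0 mul0r add0r mulr_sumr; apply: eq_bigr => i _.
  rewrite lift0 subSS -mul_bin_diag /= natrM -[i.+1%:R]natr1 [_ + 1]addrC addrA.
  by set a := (-1) ^+ _; set p := (x + _ + _) ^+ d; ring.
rewrite !IH //; last exact: ltnW.
rewrite (ltn_eqF dM) mul0n mulr0 add0r eqSS -natrM factS.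
by congr (_%:R); rewrite mulnCA.
Qed.

(** Both sides are the multinomial coefficient [N! / (i! k! (N - i - k)!)], and both vanish when
    [i + k > N]. *)
Lemma mul_bin_bin (N i k : nat) : (i <= N)%N -> (k <= N)%N ->
  ('C(N, i) * 'C(N - i, k) = 'C(N, k) * 'C(N - k, i))%N.
Proof.
move=> iN kN; case: (leqP (i + k) N) => h; last first.
  by rewrite (@bin_small (N - i)) 1?(@bin_small (N - k)) ?muln0 //; lia.
have f0 : (0 < i`! * k`! * (N - i - k)`!)%N by rewrite !muln_gt0 !fact_gt0.
apply/eqP; rewrite -(eqn_pmul2r f0); apply/eqP; transitivity N`!.
  by rewrite -(bin_fact iN) -(@bin_fact (N - i) k) ?leq_subRL //; lia.
rewrite -(bin_fact kN) -(@bin_fact (N - k) i); last by lia.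
by rewrite [(N - k - i)%N]subnAC; lia.
Qed.

(* Writing y - i = (x + y) - (x + i) turns the sum into finite differences of
   monomials. *)
Lemma abel_sum (R : comPzRingType) (N : nat) (x y : R) :
  \sum_(i < N.+1) 'C(N, i)%:R * (x + i%:R) ^+ i * (y - i%:R) ^+ (N - i) =
  \sum_(k < N.+1) ('C(N, k) * (N - k)`!)%:R * (x + y) ^+ k.
Proof.
(* The general term after the binomial expansion; its second binomial coefficient vanishes for
   [k > N - i], so the triangle of indices extends to a square and the sums can be exchanged. *)
pose E (i k : nat) : R := ('C(N, i) * 'C(N - i, k))%:R * (-1) ^+ (N - k - i) *
  (x + i%:R) ^+ (N - k) * (x + y) ^+ k.
transitivity (\sum_(i < N.+1) \sum_(k < N.+1) E i k).
  apply: eq_bigr => i _; have iN : (i <= N)%N by rewrite -ltnS.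
  have -> : y - i%:R = - (x + i%:R) + (x + y) by ring.
  rewrite [(- _ + _) ^+ _]exprDn mulr_sumr.
  rewrite -(sum_ord_widen0 (F := E i) (n := (N - i).+1)); last 2 first.
  - by rewrite ltnS leq_subr.
  - by move=> k /andP[ki _]; rewrite /E (@bin_small (N - i)) // muln0 !mul0r.
  apply: eq_bigr => k _; have kN : (k <= N - i)%N by rewrite -ltnS.
  rewrite /E -[_ * _ *+ _]mulr_natr [(- (x + _)) ^+ _]exprNn natrM.
  have -> : (N - k = i + (N - i - k))%N by lia.
  rewrite addKn exprD.
  set a := (-1) ^+ _; set p := (x + i%:R) ^+ i; set q := (x + i%:R) ^+ _.
  by set r := (x + y) ^+ k; ring.
(* For fixed [k] the sum over [i] is the difference of order [N - k] of a monomial of that same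
   degree, hence [(N - k)!]. *)
rewrite exchange_big; apply: eq_bigr => k _ /=; have kN : (k <= N)%N by rewrite -ltnS.
transitivity ('C(N, k)%:R * (x + y) ^+ k *
  \sum_(i < (N - k).+1) (-1) ^+ (N - k - i) * 'C(N - k, i)%:R * (x + i%:R) ^+ (N - k)).
  rewrite (@sum_ord_widen0 _ (fun i => (-1) ^+ (N - k - i) * 'C(N - k, i)%:R * (x + i%:R) ^+
    (N - k)) _ N.+1); last 2 first.
  - by rewrite ltnS leq_subr.
  - by move=> i /andP[ki _]; rewrite bin_small // mulr0 mul0r.
  rewrite mulr_sumr; apply: eq_bigr => i _.
  rewrite /E mul_bin_bin //; last by rewrite -ltnS.
  rewrite natrM; set a := (-1) ^+ _; set p := (x + i%:R) ^+ _; set q := (x + y) ^+ k.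
  by ring.
by rewrite finite_difference_pow // eqxx mul1n natrM mulrAC.
Qed.

(** Both sides run over the pairs of naturals with sum below [n], grouped by their sum on the left
    and by the second entry on the right. *)
Lemma triangular_sum (R : nmodType) (H : nat -> nat -> R) (n : nat) :
  \sum_(j < n) \sum_(k < j.+1) H k (j - k)%N = \sum_(c < n) \sum_(i < n - c) H i c.
Proof.
elim: n => [|n IH]; first by rewrite !big_ord0.
rewrite big_ord_recr /= IH [RHS](eq_bigr (fun c : 'I_n.+1 => \sum_(i < n - c) H i c + H (n -
  c)%N c)); last first.
  by move=> c _; rewrite subSn ?big_ord_recr // -ltnS.
rewrite big_split /=; congr (_ + _).
  by rewrite [RHS]big_ord_recr /= subnn big_ord0 addr0.
rewrite (reindex_inj rev_ord_inj); apply: eq_bigr => i _ /=.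
by rewrite subSS subKn // -ltnS.
Qed.

(** At [x = p] the partial exponential sum on the right drops out and leaves a closed form;
    [sum_tau] uses this case. *)
Lemma sum_exp_partial_sums (R : numFieldType) (x : R) (p : nat) :
  \sum_(j < p) \sum_(k < j.+1) x ^+ k / k`!%:R =
  (p%:R - x) * (\sum_(k < p) x ^+ k / k`!%:R) + p%:R * x ^+ p / p`!%:R.
Proof.
elim: p => [|p IH]; first by rewrite !big_ord0 mulr0 !mul0r addr0.
rewrite big_ord_recr /= IH !big_ord_recr /= factS natrM exprS -natr1.
have p0 : p`!%:R != 0 :> R by rewrite pnatr_eq0 -lt0n fact_gt0.
have p1 : p%:R + 1 != 0 :> R by rewrite natr1 pnatr_eq0.
by field; rewrite p1 p0.
Qed.

(** The candidate value of [nconnected n]. One more term, [k = n - 1], would add [n ^ (n - 1)], the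
    number of rooted trees, that is, of connected maps with a fixed point. *)
Definition tau (R : numFieldType) (n : nat) : R :=
  (n.-1)`!%:R * \sum_(k < n.-1) n%:R ^+ k / k`!%:R.

(** [tau] satisfies the recursion that [sum_nconnected] proves for [nconnected]. With [tau] expanded
    and [j = i + c + 2], where [i] is the index inside [tau], the sum over [i] for fixed [c] is an
    Abel sum. *)
Lemma sum_tau (R : numFieldType) (n : nat) : (0 < n)%N ->
  \sum_(j < n.+1) (j * 'C(n, j))%:R * tau R j * ((n - j - 1) ^ (n - j))%:R =
  (n * (n - 1) ^ n)%:R :> R.
Proof.
case: n => // -[|m] _.
  by rewrite !big_ord_recl big_ord0 /tau /= !big_ord0 !mulr0 !mul0r !addr0.
(* The terms [j = 0] and [j = 1] vanish, the latter because [tau R 1] is an empty sum; what remains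
   is indexed from [2]. *)
rewrite big_ord_recl [X in X + _](_ : _ = 0); last by rewrite !mul0r.
rewrite add0r big_ord_recl [X in X + _](_ : _ = 0); last first.
  by rewrite /tau /= big_ord0 mulr0 mulr0 mul0r.
rewrite add0r.
pose H (i c : nat) : R := ('C(m.+2, i + c.+2) * (i + c.+2)`!)%:R *
  (i + c.+2)%:R ^+ i / i`!%:R * (m%:R - (i + c)%:R - 1) ^+ (m - (i + c)).
have fne q : q`!%:R != 0 :> R by rewrite pnatr_eq0 -lt0n fact_gt0.
transitivity (\sum_(j < m.+1) \sum_(k < j.+1) H k (j - k)%N).
  apply: eq_bigr => j _; rewrite /tau /= /bump /= !add1n add0n mulr_sumr mulr_sumr mulr_suml.
  have jm : (j <= m)%N by rewrite -ltnS.
  apply: eq_bigr => k _; have kj : (k <= j)%N by rewrite -ltnS.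
  have -> : H k (j - k)%N = ('C(m.+2, j.+2) * (j.+2)`!)%:R *
    j.+2%:R ^+ k / k`!%:R * (m%:R - j%:R - 1) ^+ (m - j).
    by rewrite /H !addnS subnKC.
  rewrite [(j.+2)`!]factS !natrM !subSS.
  have -> : m%:R - j%:R - 1 = (m - j)%:R - 1 :> R by rewrite natrB.
  (* At [j = m] the truncated base is [0] and the ring base is [-1], but the exponent is [0], so
     both powers are [1]. *)
  case: (posnP (m - j)%N) => [->|mj]; first by rewrite !expr0; ring.
  by rewrite natrX natrB //; ring.
rewrite triangular_sum.
transitivity ((m.+2)`!%:R * \sum_(c < m.+1) \sum_(k < m.+1 - c) m.+1%:R ^+ k / k`!%:R :> R).
  rewrite mulr_sumr; apply: eq_bigr => c _.
  have cm : (c <= m)%N by rewrite -ltnS.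
  rewrite subSn //; set N := (m - c)%N.
  (* Abel's identity applies with [x = c + 2] and [y = N - 1]; their sum is [m + 1], independent of
     [c]. *)
  transitivity ((m.+2)`!%:R / N`!%:R * \sum_(i < N.+1) 'C(N, i)%:R * (c.+2%:R + i%:R) ^+ i *
    ((N%:R - 1) - i%:R) ^+ (N - i) :> R).
    rewrite mulr_sumr; apply: eq_bigr => i _; have iN : (i <= N)%N by rewrite -ltnS.
    have icm : (i + c <= m)%N by rewrite addnC -leq_subRL.
    rewrite /H natrD [i%:R + _]addrC.
    have -> : m%:R - (i + c)%:R - 1 = N%:R - 1 - i%:R :> R.
      by rewrite /N natrB // natrD; ring.
    have -> : (m - (i + c) = N - i)%N by rewrite addnC subnDA.
    have -> : (m.+2)`!%:R = ('C(m.+2, i + c.+2) * (i + c.+2)`! * (N - i)`!)%:R :> R.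
      rewrite -(@bin_fact m.+2 (i + c.+2)); last by rewrite !addnS !ltnS.
      by rewrite mulnA; congr (_ * _`!)%:R; rewrite !addnS !subSS addnC subnDA.
    have -> : N`!%:R = ('C(N, i) * i`! * (N - i)`!)%:R :> R.
      by rewrite -(bin_fact iN) mulnA.
    have bn : 'C(N, i)%:R != 0 :> R by rewrite pnatr_eq0 -lt0n bin_gt0.
    rewrite !natrM; field; rewrite !fne bn //.
  rewrite abel_sum !mulr_sumr; apply: eq_bigr => k _.
  have kN : (k <= N)%N by rewrite -ltnS.
  have -> : c.+2%:R + (N%:R - 1) = m.+1%:R :> R.
    by rewrite /N natrB // -!natr1; ring.
  have -> : N`!%:R = ('C(N, k) * k`! * (N - k)`!)%:R :> R.
    by rewrite -(bin_fact kN) mulnA.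
  have bn : 'C(N, k)%:R != 0 :> R by rewrite pnatr_eq0 -lt0n bin_gt0.
  by rewrite !natrM; field; rewrite !fne bn.
(* Regrouped, the double sum is one of partial exponential sums with [x = p = m + 1]. *)
rewrite -(triangular_sum (fun k _ => m.+1%:R ^+ k / k`!%:R)) sum_exp_partial_sums.
rewrite subrr mul0r add0r subn1 /= [(m.+2)`!]factS natrM natrM natrX -exprS.
by rewrite -mulrA [(m.+1)`!%:R * _]mulrC divfK ?fne.
Qed.

(** The recursion with constant [Phi], weighted by [j] and summed: the component sizes of each map
    add up to [n]. *)
Lemma sum_nconnected (n : nat) :
  (\sum_(j < n.+1) j * 'C(n, j) * nconnected j * (n - j - 1) ^ (n - j) =
   n * (n - 1) ^ n)%N.
Proof.
transitivity (\sum_(j < n.+1) j * sum_fpf n (fun c => (c j)%:R * 1))%N.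
  apply: eq_bigr => j _; rewrite sum_fpf_ncomponents /sum_fpf /=.
  by rewrite sum1_card card_fpf natn; ring.
rewrite /sum_fpf; under eq_bigr => j _ do rewrite big_distrr /=.
rewrite exchange_big -card_fpf mulnC -sum_nat_const /=.
apply: eq_bigr => f _; rewrite -[RHS](card_ord n) -[RHS](sum_ncomponents f) card_ord.
by apply: eq_bigr => j _; rewrite muln1 natn.
Qed.

(** Both sequences satisfy the same recursion, whose term [j = n] is [n] times the unknown; the
    earlier terms agree by induction, the one at [0] because of its factor [j]. *)
Lemma nconnected_tau (R : numFieldType) (n : nat) : (0 < n)%N ->
  (nconnected n)%:R = tau R n.
Proof.
elim/ltn_ind: n => n IH n0.
have := sum_tau R n0; rewrite -sum_nconnected natr_sum !big_ord_recr /=.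
rewrite subnn expn0 binn !muln1 !mulr1 natrM.
rewrite (eq_bigr (fun i : 'I_n => (i * 'C(n, i) * nconnected i * (n - i - 1) ^ (n - i))%:R)).
  move=> /addrI /(mulfI _) ->//.
  by rewrite pnatr_eq0 -lt0n.
move=> i _; case: (posnP i) => [->|i0]; first by rewrite !mul0r.
by rewrite -IH // -!natrM.
Qed.

End Abel.

(** * Limits of the point probabilities *)

Section Limits.
Local Open Scope classical_set_scope.
Local Open Scope ring_scope.
Context {R : realType}.

(* The mean number of components of size j, by [mean_fpf_ncomponents] at 1. *)
Definition component_rate (n j : nat) : R :=
  ('C(n, j) * nconnected j)%:R * ((n - j - 1) ^ (n - j))%:R / ((n - 1) ^ n)%:R.

(** The Poisson probability is [expR (- j)] times the very sum in [tau], and [j * (j - 1)! = j!]. *)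
Lemma lambda_tilde_nconnected (j : nat) : (2 <= j)%N ->
  lambda_tilde R j = (nconnected j)%:R / j`!%:R * expR (- j%:R).
Proof.
case: j => // -[//|j] _.
rewrite /lambda_tilde /poisson_law /poisson_prob ltr0Sn.
rewrite (_ : [set k | (k < j.+2 - 1)%N] = `I_(j.+1)); last by rewrite subn1.
rewrite esum_fset; first last.
- by move=> i _; rewrite lee_fin poisson_pmf_ge0.
- exact: finite_II.
rewrite -fsbig_ord sumEFin /= nconnected_tau // /tau /poisson_pmf ltr0Sn.
rewrite -mulr_suml [(j.+2)`!]factS natrM /=.
have f0 : (j.+1)`!%:R != 0 :> R by rewrite pnatr_eq0 -lt0n fact_gt0.
by field; rewrite f0 -natrD pnatr_eq0.
Qed.

(** For [j >= 2] the term [k = 0] is present. Positivity selects the genuine Poisson branch of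
    [poisson_prob]. *)
Lemma lambda_tilde_gt0 (j : nat) : (2 <= j)%N -> 0 < lambda_tilde R j.
Proof.
case: j => // -[//|j] _; rewrite lambda_tilde_nconnected // mulr_gt0 ?expR_gt0 //.
rewrite divr_gt0 ?ltr0n ?fact_gt0 // -(@ltr0n R) nconnected_tau // /tau mulr_gt0 //.
by rewrite big_ord_recl ltr_pwDl // ?expr0 ?divr1 // sumr_ge0.
Qed.

Lemma cvg_divn (c : R) (k : nat) : c / (n + k.+1)%:R @[n --> \oo] --> 0.
Proof.
have h : (@harmonic R \o (fun n => (n + k)%N)) @ \oo --> 0.
  by have := @cvg_harmonic R; rewrite -(cvg_shiftn k).
rewrite -[X in _ --> X](mulr0 c); under eq_cvg do rewrite addnS.
exact: cvgM (cvg_cst c) h.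
Qed.

(** The inequality [1 + x <= expR x], applied to the inverse [1 + j / (n + 1)] of the ratio, gives
    the lower bound; applied to the ratio [1 - j / (n + j + 1)] itself, it gives the upper bound. *)
Lemma cvg_ratio_pow (j : nat) :
  (n.+1%:R / (n + j.+1)%:R) ^+ n.+1 @[n --> \oo] --> expR (- j%:R : R).
Proof.
have hx n : n.+1%:R / (n + j.+1)%:R = 1 - j%:R / (n + j.+1)%:R :> R.
  by rewrite -addSnnS natrD; field.
have hy n : (n + j.+1)%:R / n.+1%:R = 1 + j%:R / n.+1%:R :> R.
  by rewrite -addSnnS natrD; field.
apply: (@squeeze_cvgr _ _ _ _ (fun=> expR (- j%:R)) (fun n => expR (- j%:R + j%:R * (j%:R /
  (n + j.+1)%:R)))).
- apply: nearW => n; apply/andP; split.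
    rewrite -[leRHS]invrK -exprVn invf_div hy expRN lef_pV2 ?posrE ?expR_gt0 ?exprn_gt0 //.
    rewrite -[X in expR X](@divfK _ (n.+1%:R : R)) ?pnatr_eq0 // expRM_natr.
    by rewrite lerXn2r ?nnegrE ?expR_ge1Dx ?expR_ge0 // addr_ge0 // divr_ge0.
  have -> : - j%:R + j%:R * (j%:R / (n + j.+1)%:R) = (- (j%:R / (n + j.+1)%:R)) * n.+1%:R :> R.
    by rewrite -addSnnS natrD; field.
  rewrite expRM_natr lerXn2r ?nnegrE ?expR_ge0 ?divr_ge0 //.
  by rewrite hx expR_ge1Dx.
- exact: cvg_cst.
- apply: (@continuous_cvg _ _ _ _ _ _ expR); first exact: continuous_expR.
  rewrite -[X in _ --> X]addr0; apply: cvgD; first exact: cvg_cst.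
  rewrite -[X in _ --> X](mulr0 j%:R); apply: cvgM; first exact: cvg_cst.
  exact: cvg_divn.
Qed.

Lemma cvg_component_rate (j : nat) :
  component_rate n j @[n --> \oo] --> (nconnected j)%:R / j`!%:R * expR (- j%:R).
Proof.
(* The rate at [n + j + 2], a shift that makes all truncated subtractions exact. The product is the
   falling factorial over [(n + j + 1) ^ j]; the power of exponent [n + 2] is split to isolate the
   one in [cvg_ratio_pow]. *)
pose u (n : nat) : R := (nconnected j)%:R / j`!%:R *
  ((\prod_(i < j) (1 + (1 - i%:R) / (n + j.+1)%:R)) *
   ((n.+1%:R / (n + j.+1)%:R) ^+ n.+1 * (1 - j%:R / (n + j.+1)%:R))).
have ue : [sequence component_rate (n + j.+2)%N j]_n = u.
  apply/funext => n /=; rewrite /component_rate /u.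
  have -> : (n + j.+2 - j = n.+2)%N by lia.
  have -> : (n + j.+2 - 1 = n + j.+1)%N by lia.
  rewrite !subSS subn0 !natrX natrM.
  have a0 : (n + j.+1)%:R != 0 :> R by rewrite pnatr_eq0 addnS.
  have -> : 'C(n + j.+2, j)%:R = \prod_(i < j) ((n + j.+2)%:R - i%:R) / j`!%:R :> R.
    apply: (canRL (mulfK _)); first by rewrite pnatr_eq0 -lt0n fact_gt0.
    rewrite -natrM bin_ffact ffact_prod natr_prod; apply: eq_bigr => i _.
    by rewrite natrB //; have := ltn_ord i; lia.
  have -> : \prod_(i < j) (1 + (1 - i%:R) / (n + j.+1)%:R) =
     (\prod_(i < j) ((n + j.+2)%:R - i%:R)) / (n + j.+1)%:R ^+ j :> R.
    rewrite -[X in _ / _ ^+ X](card_ord j) -prodr_const -prodf_div; apply: eq_bigr => i _.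
    by rewrite addnS -natr1; field.
  have -> : 1 - j%:R / (n + j.+1)%:R = n.+1%:R / (n + j.+1)%:R :> R.
    by rewrite -addSnnS natrD; field.
  have -> : (n + j.+2 = j + n.+2)%N by lia.
  rewrite expr_div_n exprD [_ ^+ n.+2]exprS [_ ^+ n.+2]exprS.
  set p := \prod_(i < j) _; set a := (n + j.+1)%:R ^+ j; set b := _ ^+ n.+1.
  set c := (n + j.+1)%:R ^+ n.+1.
  by field; rewrite pnatr_eq0 -lt0n fact_gt0 nat1r -natrD a0 !expf_neq0.
suff : u @ \oo --> (nconnected j)%:R / j`!%:R * expR (- j%:R : R).
  by move=> cu; rewrite -(cvg_shiftn j.+2) ue; exact: cu.
apply: cvgM; first exact: cvg_cst.
rewrite -[X in _ --> X]mul1r; apply: cvgM.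
  have e1 : \prod_(i < j) (1 : R) = 1 by rewrite big1.
  rewrite -[X in _ --> X]e1; apply: cvg_big => [|i _]; first exact: mul_continuous.
  rewrite -[X in _ --> X]addr0; apply: cvgD; [exact: cvg_cst|exact: cvg_divn].
rewrite -[X in _ --> X]mulr1; apply: cvgM; first exact: cvg_ratio_pow.
rewrite -[X in _ --> X]subr0; apply: cvgB; [exact: cvg_cst|exact: cvg_divn].
Qed.

End Limits.

(** * Factorial moments and joint law of the small component counts *)

Section FactorialMoments.
Local Open Scope classical_set_scope.
Local Open Scope ring_scope.
Context {R : realType}.

(* For n = 1 there is no fixed-point-free map and the value is 0 / 0 = 0. *)
Definition mean_fpf (n : nat) (Phi : (nat -> nat) -> R) : R :=
  sum_fpf n Phi / ((n - 1) ^ n)%:R.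

(** A zero denominator means that no fixed-point-free map exists, and then the sum is empty too.
    This lets the recursion for means hold for all [n] and [j]. *)
Lemma mean_fpfK n Phi : mean_fpf n Phi * ((n - 1) ^ n)%:R = sum_fpf n Phi.
Proof.
rewrite /mean_fpf; have [F0|F0] := eqVneq (((n - 1) ^ n)%:R : R) 0; last by rewrite divfK.
rewrite F0 mulr0 /sum_fpf big1 // => f ff; exfalso.
move/eqP: F0; rewrite pnatr_eq0 -card_fpf => /eqP/card0_eq/(_ f).
by rewrite ff.
Qed.

Lemma mean_fpf_ncomponents n j Phi :
  mean_fpf n (fun c => (c j)%:R * Phi c) =
  component_rate n j * mean_fpf (n - j) (fun c => Phi (fun i => (c i + (i == j))%N)).
Proof.
rewrite {1}/mean_fpf sum_fpf_ncomponents -mean_fpfK /component_rate.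
by rewrite [mean_fpf _ _ * _]mulrC mulrA mulrAC.
Qed.

Lemma mean_fpf_sum n (I : finType) (Phi : I -> (nat -> nat) -> R) :
  mean_fpf n (fun c => \sum_i Phi i c) = \sum_i mean_fpf n (Phi i).
Proof. by rewrite /mean_fpf /sum_fpf exchange_big mulr_suml. Qed.

Lemma mean_fpfZ n a Phi : mean_fpf n (fun c => a * Phi c) = a * mean_fpf n Phi.
Proof. by rewrite /mean_fpf /sum_fpf -mulr_sumr mulrA. Qed.

Lemma ler_mean_fpf n (Phi Psi : (nat -> nat) -> R) : (forall c, `|Phi c| <= Psi c) ->
  `|mean_fpf n Phi| <= mean_fpf n Psi.
Proof.
move=> le; rewrite /mean_fpf normrM [X in _ * X]ger0_norm ?invr_ge0 //.
rewrite ler_wpM2r ?invr_ge0 // (le_trans (ler_norm_sum _ _ _)) //.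
by apply: ler_sum.
Qed.

Lemma mean_fpfB n (Phi Psi : (nat -> nat) -> R) :
  mean_fpf n (fun c => Phi c - Psi c) = mean_fpf n Phi - mean_fpf n Psi.
Proof. by rewrite /mean_fpf /sum_fpf sumrB mulrBl. Qed.

Lemma mean_fpf1 n : (2 <= n)%N -> mean_fpf n (fun=> 1) = 1.
Proof.
move=> n2; rewrite /mean_fpf /sum_fpf sumr_const card_fpf divff //.
by rewrite pnatr_eq0 -lt0n expn_gt0 subn_gt0 n2.
Qed.

Section Truncation.
Variable p : nat.

(** The [S] of the overview: the sizes counted are [2, ..., p + 1], and [p = b - 1] in the
    theorem. *)
Definition small_components (c : nat -> nat) : nat := (\sum_(i < p) c (i + 2))%N.

Lemma small_components_add (c : nat -> nat) (i : 'I_p) :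
  small_components (fun k => c k + (k == i + 2))%N = (small_components c).+1.
Proof.
rewrite /small_components big_split /= -[RHS]addn1; congr (_ + _)%N.
rewrite (bigD1 i) //= eqxx big1 // => k ki.
by rewrite eqn_add2r val_eqE (negbTE ki).
Qed.

Definition total_rate : R := \sum_(i < p) lambda_tilde R (i + 2).

Lemma cvg_component_rate_tilde (j : nat) : (2 <= j)%N ->
  component_rate n j @[n --> \oo] --> lambda_tilde R j.
Proof. by move=> j2; rewrite lambda_tilde_nconnected //; exact: cvg_component_rate. Qed.

(** Induction on [k] through [(k + 1) 'C(S, k + 1) = S 'C(S - 1, k)]: the factor [S] is a sum of
    counts, and removing the counted component by the recursion turns [S - 1] into the [S] of a
    smaller map. *)
Lemma cvg_mean_binomial (k : nat) :
  mean_fpf n (fun c => 'C(small_components c, k)%:R) @[n --> \oo] -->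
  total_rate ^+ k / k`!%:R.
Proof.
elim: k => [|k IH].
  rewrite expr0 divr1; apply: cvg_near_cst; exists 2 => // n /= n2.
  rewrite -[RHS](mean_fpf1 n2); congr mean_fpf; apply/funext => c; by rewrite bin0.
have rec n : mean_fpf n (fun c => 'C(small_components c, k.+1)%:R) =
    k.+1%:R^-1 * \sum_(i < p) component_rate n (i + 2) *
      mean_fpf (n - (i + 2)) (fun c => 'C(small_components c, k)%:R).
  apply: (canRL (mulKf _)); first by rewrite pnatr_eq0.
  rewrite -mean_fpfZ.
  transitivity (mean_fpf n (fun c => \sum_(i < p) (c (i + 2)%N)%:R * 'C((small_components
    c).-1, k)%:R)).
    congr mean_fpf; apply/funext => c.
    by rewrite -mulr_suml -natr_sum -!natrM -mul_bin_diag.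
  rewrite mean_fpf_sum; apply: eq_bigr => i _; rewrite mean_fpf_ncomponents.
  by congr (_ * mean_fpf _ _); apply/funext => c; rewrite small_components_add.
under eq_cvg do rewrite rec.
have -> : total_rate ^+ k.+1 / (k.+1)`!%:R =
    k.+1%:R^-1 * \sum_(i < p) lambda_tilde R (i + 2) * (total_rate ^+ k / k`!%:R).
  by rewrite -mulr_suml -/total_rate exprS factS natrM invfM; ring.
apply: cvgM; first exact: cvg_cst.
apply: cvg_big => [|i _]; first exact: add_continuous.
apply: cvgM; first by apply: cvg_component_rate_tilde; rewrite addn2.
by rewrite -(cvg_centern (i + 2)) in IH.
Qed.

Lemma alternating_binomial_sum (S K : nat) :
  \sum_(k < K.+1) (-1) ^+ k * 'C(S.+1, k)%:R = (-1) ^+ K * 'C(S, K)%:R :> R.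
Proof.
elim: K => [|K IH]; first by rewrite big_ord_recl big_ord0 /= !bin0 addr0.
by rewrite big_ord_recr /= IH binS natrD exprS; ring.
Qed.

(** For positive [S] and [K] the alternating sum is, up to sign, ['C(S - 1, K - 1)], which Pascal's
    rule bounds by ['C(S, K)]. *)
Lemma bonferroni (S K : nat) :
  `|(S == 0%N)%:R - \sum_(k < K) (-1) ^+ k * 'C(S, k)%:R| <= 'C(S, K)%:R :> R.
Proof.
case: K => [|K]; first by rewrite big_ord0 subr0 normr_nat bin0 ler_nat leq_b1.
case: S => [|S].
  rewrite big_ord_recl big1 => [|i _]; last by rewrite /= bin0n mulr0.
  by rewrite expr0 bin0 mulr1 addr0 subrr normr0.
rewrite alternating_binomial_sum sub0r normrN normrM normrX normrN normr1 expr1n mul1r.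
by rewrite normr_nat ler_nat binS leq_addl.
Qed.

Lemma cvg_mean_no_small_component :
  mean_fpf n (fun c => (small_components c == 0%N)%:R) @[n --> \oo] -->
  expR (- total_rate).
Proof.
apply/cvgrPdist_lt => e e0; have e4 : 0 < e / 4 by rewrite divr_gt0.
have cK : series (exp_coeff (- total_rate)) @ \oo --> expR (- total_rate).
  exact: is_cvg_series_exp_coeff.
(* [K] is fixed before [n]: it controls both the tail of the exponential series and the limit of the
   Bonferroni error. Three errors below [e / 4] will add up. *)
have [K [h1 h2]] : exists K,
    `|expR (- total_rate) - series (exp_coeff (- total_rate)) K| < e / 4 /\
    total_rate ^+ K / K`!%:R < e / 4.
  have n1 : \forall K \near \oo,
    `|expR (- total_rate) - series (exp_coeff (- total_rate)) K| < e / 4.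
    by move/cvgrPdist_lt : cK; apply.
  have n2 : \forall K \near \oo, total_rate ^+ K / K`!%:R < e / 4.
    by have /cvgr_lt := cvg_exp_coeff total_rate; apply.
  by have [K [? ?]] := filter_ex (filterI n1 n2); exists K.
pose t n := \sum_(k < K) (-1) ^+ k * mean_fpf n (fun c => 'C(small_components c, k)%:R).
have ct : t @ \oo --> series (exp_coeff (- total_rate)) K.
  rewrite /series /= big_mkord; apply: cvg_big => [|k _]; first exact: add_continuous.
  rewrite /exp_coeff /= [(- total_rate) ^+ k]exprNn -[X in _ --> X]mulrA; apply: cvgM; first
    exact: cvg_cst.
  exact: cvg_mean_binomial.
have n3 : \forall n \near \oo, `|series (exp_coeff (- total_rate)) K - t n| < e / 4.
  by move/cvgrPdist_lt : ct; apply.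
have n4 : \forall n \near \oo, mean_fpf n (fun c => 'C(small_components c, K)%:R) < e / 4.
  by have /cvgr_lt := cvg_mean_binomial (k := K); apply.
near=> n.
have b : `|mean_fpf n (fun c => (small_components c == 0%N)%:R) - t n| < e / 4.
  apply: le_lt_trans (near n4 n _) => //.
  rewrite /t; under eq_bigr do rewrite -mean_fpfZ.
  rewrite -mean_fpf_sum -mean_fpfB; apply: ler_mean_fpf => c; exact: bonferroni.
have a : `|series (exp_coeff (- total_rate)) K - t n| < e / 4 by exact: (near n3 n).
move: h1 a b; rewrite !ltr_norml => /andP[? ?] /andP[? ?] /andP[? ?].
by apply/andP; split; lra.
Unshelve. all: by end_near. Qed.

(** Finite functions into [nat] form a countable type, on which the law is given by its point
    masses. *)
Definition small_component_counts (c : nat -> nat) : {ffun 'I_p -> nat} :=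
  [ffun i : 'I_p => c (i + 2)%N].

Lemma cvg_mean_small_component_counts (m : {ffun 'I_p -> nat}) :
  mean_fpf n (fun c => (small_component_counts c == m)%:R) @[n --> \oo] -->
  \prod_(i < p) (lambda_tilde R (i + 2) ^+ m i / (m i)`!%:R * expR (- lambda_tilde R (i + 2))).
Proof.
(* Induction on a bound for the total of [m]; in the base case [m] is zero and the event is that no
   small component exists. *)
elim: {m}(\sum_i m i)%N {-2}m (leqnn (\sum_i m i)%N) => [|s IH] m.
  rewrite leqn0 sum_nat_eq0 => /forallP /= m0.
  have -> : \prod_(i < p) (lambda_tilde R (i + 2) ^+ m i / (m i)`!%:R * expR (- lambda_tilde
    R (i + 2)))
      = expR (- total_rate).
    rewrite /total_rate -sumrN expR_sum; apply: eq_bigr => i _.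
    by rewrite (eqP (m0 i)) expr0 divr1 mul1r.
  rewrite (_ : (fun n => _) = fun n => mean_fpf n (fun c => (small_components c == 0%N)%:R)).
    exact: cvg_mean_no_small_component.
  apply/funext => n; congr mean_fpf; apply/funext => c; congr (nat_of_bool _)%:R.
  rewrite sum_nat_eq0; apply/eqP/forallP => [cm i|c0].
    by have := m0 i; rewrite /= -cm ffunE.
  by apply/ffunP => i; rewrite ffunE (eqP (c0 i)) (eqP (m0 i)).
have [/existsP[i mi] ms|] := boolP [exists i, m i != 0%N]; last first.
  rewrite negb_exists => /forallP m0 _; apply: IH.
  by rewrite big1 // => i _; have := m0 i; rewrite negbK => /eqP.
pose m' := [ffun k : 'I_p => m k - (k == i)]%N.
have mE : m = [ffun k : 'I_p => m' k + (k == i)]%N.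
  by apply/ffunP => k; rewrite !ffunE subnK //; case: eqP => // ->; rewrite lt0n.
have mi' : m i = (m' i).+1 by rewrite ffunE eqxx subn1 prednK ?lt0n.
have rec n : mean_fpf n (fun c => (small_component_counts c == m)%:R) =
  (m i)%:R^-1 * (component_rate n (i + 2) *
  mean_fpf (n - (i + 2)) (fun c => (small_component_counts c == m')%:R)).
  apply: (canRL (mulKf _)); first by rewrite pnatr_eq0.
  rewrite -[LHS]mean_fpfZ.
  (* On the event that the counts equal [m], the constant [m i] is the count itself, to which the
     recursion applies. *)
  transitivity (mean_fpf n (fun c => (c (i + 2)%N)%:R * (small_component_counts c == m)%:R)).
    congr mean_fpf; apply/funext => c; case: eqP => [<-|]; last by rewrite !mulr0.
    by rewrite ffunE.
  rewrite mean_fpf_ncomponents; congr (_ * mean_fpf _ _); apply/funext => c.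
  congr (nat_of_bool _)%:R; apply/eqP/eqP => /ffunP cm; apply/ffunP => k.
    have := cm k; rewrite !ffunE eqn_add2r val_eqE => <-.
    by rewrite addnK.
  by rewrite mE [RHS]ffunE -cm !ffunE eqn_add2r val_eqE.
under eq_cvg do rewrite rec.
have -> : \prod_(k < p) (lambda_tilde R (k + 2) ^+ m k / (m k)`!%:R * expR (- lambda_tilde R
  (k + 2)))
  = (m i)%:R^-1 * (lambda_tilde R (i + 2) *
   \prod_(k < p) (lambda_tilde R (k + 2) ^+ m' k / (m' k)`!%:R * expR (- lambda_tilde R (k + 2)))).
  rewrite (bigD1 i) //= [in RHS](bigD1 i) //=.
  move: (lambda_tilde R (i + 2)) => L; rewrite !mulrA; congr (_ * _).
    rewrite mi' factS natrM invfM exprS; ring.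
  by apply: eq_bigr => k ki; rewrite !ffunE (negbTE ki) subn0.
apply: cvgM; first exact: cvg_cst.
apply: cvgM; first by apply: cvg_component_rate_tilde; rewrite addn2.
have : (\sum_k m' k <= s)%N.
  rewrite -ltnS (leq_trans _ ms) // [leqRHS](bigD1 i) //= (bigD1 i) //= mi' addSn ltnS.
  by rewrite leq_add2l; apply: leq_sum => k _; rewrite ffunE leq_subr.
by move=> /IH; rewrite -(cvg_centern (i + 2)).
Qed.

End Truncation.
End FactorialMoments.

(** * Laws of discrete random variables *)

Section DiscreteConvergence.
Local Open Scope classical_set_scope.
Local Open Scope ring_scope.
Context {R : realType} (V : countType).

Section OneSpace.
Context d (T : measurableType d) (P : probability T R) (X : T -> V).
Hypothesis mX : forall v, measurable (X @^-1` [set v]).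

Definition point_prob (v : V) : R := fine (P (X @^-1` [set v])).

Lemma point_probE v : P (X @^-1` [set v]) = (point_prob v)%:E.
Proof. by rewrite /point_prob fineK // fin_num_measure. Qed.

Lemma measurable_discrete (A : set V) : measurable (X @^-1` A).
Proof.
have -> : X @^-1` A = \bigcup_v (if v \in A then X @^-1` [set v] else set0).
  apply/seteqP; split => [w Aw|w [v _]] /=.
    by exists (X w) => //; rewrite mem_set.
  by case: ifPn => //; rewrite inE => Av /= ->.
apply: countable_bigcupT_measurable => [|v]; first exact: countableP.
by case: ifPn.
Qed.

Lemma measurable_fun_discrete (g : V -> R) : measurable_fun setT (g \o X).
Proof. by move=> _ Y _; rewrite setTI comp_preimage; exact: measurable_discrete. Qed.

Lemma bigsetU_discrete (s : seq V) :
  \big[setU/set0]_(v <- s) X @^-1` [set v] = X @^-1` [set` s].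
Proof.
rewrite -bigcup_seq; apply/seteqP; split => [w [v vs /= Xw]|w ws] /=.
  by rewrite Xw.
by exists (X w).
Qed.

Lemma trivIset_discrete (A : set V) : trivIset A (fun v => X @^-1` [set v]).
Proof. by move=> u v _ _ [w [/= <- <-]]. Qed.

Lemma sum_point_prob (s : seq V) : uniq s -> (\sum_(v <- s) point_prob v)%:E = P (X @^-1` [set` s]).
Proof.
move=> us; rewrite -sumEFin; under eq_bigr do rewrite -point_probE.
(* Finite additivity over the disjoint fibres, read off from the integral of the constant [1]. *)
have := @integral_bigsetU_EFin _ _ _ P _ (fun v => X @^-1` [set v]) (cst 1) s mX us
  (@trivIset_discrete _).
rewrite /= bigsetU_discrete integral_cst ?mul1e; last exact: measurable_discrete.
move=> ->; last by apply/measurable_EFinP; exact: measurable_cst.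
by apply: eq_bigr => v _; rewrite integral_cst ?mul1e.
Qed.

(** Outside the preimage of [s] the integrand is at most [M] in absolute value, on a set whose
    probability is the missing mass. *)
Lemma expectation_discrete (g : V -> R) (M : R) (s : seq V) :
  (forall v, `|g v| <= M) -> uniq s ->
  exists2 r : R, 'E_P[g \o X]%E = r%:E &
    `|r - \sum_(v <- s) g v * point_prob v| <= M * (1 - \sum_(v <- s) point_prob v).
Proof.
move=> gM us; set D := X @^-1` [set` s].
have mD : measurable D by exact: measurable_discrete.
have mg A : measurable A -> measurable_fun A (EFin \o (g \o X)).
  move=> mA; apply/measurable_EFinP; apply: measurable_funTS.
  exact: measurable_fun_discrete.
have E : 'E_P[g \o X]%E = ((\sum_(v <- s) g v * point_prob v)%:E + \int[P]_(w in ~` D) (g (X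
  w))%:E)%E.
  rewrite unlock -(setUv D) integral_setU //; last 3 first.
  - exact: measurableC.
  - by rewrite setUv; exact: mg.
  - by apply/disj_set2P; rewrite setICr.
  congr (_ + _)%E.
  have := @integral_bigsetU_EFin _ _ _ P _ (fun v => X @^-1` [set v]) (g \o X) s mX us
    (@trivIset_discrete _).
  rewrite /= bigsetU_discrete => -> //; last exact: mg.
  rewrite -sumEFin; apply: eq_bigr => v _.
  rewrite (eq_integral (cst (g v)%:E)); last by move=> w; rewrite inE => /= ->.
  by rewrite integral_cst // EFinM -point_probE.
have B : (`|\int[P]_(w in ~` D) (g (X w))%:E| <= (M * (1 - \sum_(v <- s) point_prob v))%:E)%E.
  apply: le_trans (le_abse_integral _ _ _) _; [exact: measurableC|by apply: mg; exact:
    measurableC|].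
  apply: (@le_trans _ _ (\int[P]_(w in ~` D) (cst M%:E w))%E).
    apply: ge0_le_integral => //; first exact: measurableC.
    - by apply: measurableT_comp => //; apply: mg; exact: measurableC.
    - by move=> w _; rewrite lee_fin.
  rewrite integral_cst; last exact: measurableC.
  by rewrite EFinM EFinB sum_point_prob // -(probability_setC P mD).
have : (\int[P]_(w in ~` D) (g (X w))%:E)%E \is a fin_num.
  by rewrite fin_num_abs (le_lt_trans B) // ltry.
move=> /fineK Ir; rewrite -Ir in E B.
exists (\sum_(v <- s) g v * point_prob v + fine (\int[P]_(w in ~` D) (g (X w))%:E)).
  by rewrite E -EFinD.
by rewrite addrAC subrr add0r -lee_fin.
Qed.

(** The values with code below [K]: finite lists that exhaust [V] as [K] grows. *)
Definition pickle_seq (K : nat) : seq V := pmap (@pickle_inv V) (iota 0 K).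

Lemma mem_pickle_seq K v : (v \in pickle_seq K) = (choice.pickle v < K)%N.
Proof.
rewrite mem_pmap; apply/mapP/idP => [[n]|vK].
  rewrite mem_iota add0n /= => nK /esym vn.
  by have := @pickle_invK V n; rewrite vn /= => ->.
by exists (choice.pickle v); rewrite ?mem_iota // pickleK_inv.
Qed.

Lemma uniq_pickle_seq K : uniq (pickle_seq K).
Proof. by apply: (pmap_uniq (@pickle_invK V)); exact: iota_uniq. Qed.

Lemma cvg_sum_point_prob : \sum_(v <- pickle_seq K) point_prob v @[K --> \oo] --> (1 : R).
Proof.
have -> : (fun K => \sum_(v <- pickle_seq K) point_prob v) =
    fine \o (P \o (fun K => X @^-1` [set` pickle_seq K])).
  by apply/funext => K; rewrite /= -sum_point_prob ?uniq_pickle_seq.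
apply: fine_cvg.
have cover : \bigcup_K (X @^-1` [set` pickle_seq K]) = setT.
  by apply/seteqP; split => // w _; exists (choice.pickle (X w)).+1 => //=; rewrite mem_pickle_seq.
rewrite -(@probability_setT _ _ _ P) -cover; apply: nondecreasing_cvg_mu.
- by move=> K; exact: measurable_discrete.
- by rewrite cover.
move=> K L KL; apply/subsetPset => w /=.
by rewrite !mem_pickle_seq => /leq_trans; exact.
Qed.

End OneSpace.

(* Scheffe: since the limit has total mass 1, convergence of the point masses
   already prevents the escape of mass. *)
Lemma cvg_expectation_discrete
    (dn : nat -> measure_display) (Tn : forall n, measurableType (dn n))
    (Pn : forall n, probability (Tn n) R) (Xn : forall n, Tn n -> V)
    d (T : measurableType d) (P : probability T R) (X : T -> V)
    (mXn : \forall n \near \oo, forall v, measurable (@Xn n @^-1` [set v]))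
    (mX : forall v, measurable (X @^-1` [set v]))
    (cX : forall v, point_prob (Pn n) (@Xn n) v @[n --> \oo] --> point_prob P X v)
    (g : V -> R) (M : R) (gM : forall v, `|g v| <= M) :
  'E_(Pn n)[g \o @Xn n]%E @[n --> \oo] --> 'E_P[g \o X]%E.
Proof.
(* A bound on absolute values is nonnegative once [V] has a point; one exists because [P] has mass
   [1], so [T] is nonempty. *)
have M0 : 0 <= M.
  have [v _] : exists v : V, True.
    have [w _] : [set: T] !=set0.
      apply/set0P/negP => /eqP T0; have := @probability_setT _ _ _ P.
      by rewrite T0 measure0 => /eqP; rewrite eqe eq_sym oner_eq0.
    by exists (X w).
  exact: le_trans (normr_ge0 _) (gM v).
have [r rE rs] : exists2 r : R, 'E_P[g \o X]%E = r%:E & forall s, uniq s ->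
    `|r - \sum_(v <- s) g v * point_prob P X v| <= M * (1 - \sum_(v <- s) point_prob P X v).
  have [r E _] := expectation_discrete P mX gM (isT : uniq [::]).
  exists r => // s us; have [r' E'] := expectation_discrete P mX gM us.
  by move: E'; rewrite E => -[->].
rewrite rE; apply: cvg_EFin.
  apply: filterS mXn => n mn.
  by have [q -> _] := expectation_discrete (Pn n) mn gM (isT : uniq [::]).
apply/cvgrPdist_lt => e e0.
(* [M + 1] rather than [M], to cover [M = 0]. *)
pose e' := e / (4 * (M + 1)).
have e'0 : 0 < e' by rewrite divr_gt0 // mulr_gt0 // ltr_wpDl.
have Me' : M * e' < e / 4.
  have -> : e / 4 = (M + 1) * e' by rewrite /e'; field; rewrite gt_eqF // ltr_wpDl.
  by rewrite ltr_pM2r // ltrDl.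
have [K hK] : exists K, 1 - \sum_(v <- pickle_seq K) point_prob P X v < e'.
  have /cvgr_gt := cvg_sum_point_prob P mX.
  move=> /(_ (1 - e')) []; first by rewrite gtrDl oppr_lt0.
  by move=> K _ /(_ K (leqnn K)) /= h; exists K; lra.
set s := pickle_seq K in hK; have us : uniq s by exact: uniq_pickle_seq.
have c1 : \sum_(v <- s) point_prob (Pn n) (@Xn n) v @[n --> \oo] --> \sum_(v <- s) point_prob P X v.
  by apply: cvg_big => [|v _]; [exact: add_continuous|exact: cX].
have c2 : \sum_(v <- s) g v * point_prob (Pn n) (@Xn n) v @[n --> \oo] --> \sum_(v <- s) g v
  * point_prob P X v.
  apply: cvg_big => [|v _]; first exact: add_continuous.
  by apply: cvgM; [exact: cvg_cst|exact: cX].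
(* The finite set [s] eventually carries almost all the mass of the [n]-th law as well. *)
have n1 : \forall n \near \oo, 1 - e' < \sum_(v <- s) point_prob (Pn n) (@Xn n) v.
  by have /cvgr_gt := c1; apply; lra.
have n2 : \forall n \near \oo, `|\sum_(v <- s) g v * point_prob P X v - \sum_(v <- s) g v *
  point_prob (Pn n) (@Xn n) v| < e / 4.
  by move/cvgrPdist_lt : c2; apply; rewrite divr_gt0.
near=> n.
have mn : forall v, measurable (@Xn n @^-1` [set v]) by near: n.
have [q qE qs] := expectation_discrete (Pn n) mn gM us.
rewrite /= qE /=.
have b1 : `|r - \sum_(v <- s) g v * point_prob P X v| < e / 4.
  by apply: le_lt_trans (rs _ us) _; apply: le_lt_trans Me'; rewrite ler_wpM2l // ltW.
have b2 : `|q - \sum_(v <- s) g v * point_prob (Pn n) (@Xn n) v| < e / 4.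
  apply: le_lt_trans qs _; apply: le_lt_trans Me'; rewrite ler_wpM2l //.
  have : 1 - e' < \sum_(v <- s) point_prob (Pn n) (@Xn n) v by near: n.
  by move=> h; lra.
have b3 : `|\sum_(v <- s) g v * point_prob P X v - \sum_(v <- s) g v * point_prob (Pn n) (@Xn
  n) v| < e / 4.
  by near: n.
move: b1 b2 b3; rewrite !ltr_norml => /andP[? ?] /andP[? ?] /andP[? ?].
by apply/andP; split; lra.
Unshelve. all: by end_near. Qed.

End DiscreteConvergence.

(** * The law of the screaming toes mapping and of its counts *)

Section ScreamingToes.
Local Open Scope classical_set_scope.
Local Open Scope ring_scope.
Context {R : realType}.

Lemma screaming_toes_point_prob (n : nat) d (T : measurableType d) (P : probability T R)
    (B : 'I_n -> T -> 'I_n) (n2 : (2 <= n)%N) (hB : screaming_toes P B) (f : {ffun 'I_n -> 'I_n}) :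
  point_prob P (fun w => [ffun i => B i w]) f = (f \in fpf 'I_n)%:R / ((n - 1) ^ n)%:R.
Proof.
have [mB indep toes] := hB.
have n1 : (n - 1)%N%:R != 0 :> R by rewrite pnatr_eq0 subn_eq0 -ltnNge.
have toe (i j : 'I_n) : point_prob P (B i) j = (j != i)%:R / (n - 1)%N%:R.
  have mBi v : measurable (B i @^-1` [set v]) by exact: mB.
  have pj k : k != i -> point_prob P (B i) k = (n - 1)%N%:R^-1.
    by move=> ki; have := toes i k ki; rewrite /point_prob => ->.
  have [->|ji] := eqVneq j i; last by rewrite pj // mul1r.
  (* The [n - 1] values other than [i] already have total mass [1], which forces probability [0] at
     [i]. *)
  rewrite mul0r; have := sum_point_prob P mBi (enum_uniq 'I_n).
  rewrite (_ : [set` enum 'I_n] = setT); last first.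
    by apply/seteqP; split => // k _ /=; rewrite mem_enum.
  rewrite preimage_setT probability_setT big_enum /= => -[].
  rewrite (bigD1 i) //= (eq_bigr (fun=> (n - 1)%N%:R^-1)) // sumr_const cardC1 card_ord.
  rewrite -subn1 -[_ *+ _]mulr_natl divff //.
  by move=> h; apply: (addIr 1); rewrite add0r.
pose S : {fset 'I_n} := [fset i in enum 'I_n]%fset.
have inS i : i \in S by rewrite inE /= mem_enum.
have Spe : perm_eq (enum_fset S) (index_enum 'I_n).
  by apply: uniq_perm; rewrite ?fset_uniq ?index_enum_uniq // => i; rewrite mem_index_enum inS.
have := indep S (fun i => [set f i]) (fun _ _ => I) (fun _ _ => I).
rewrite (perm_big _ Spe) /=.
have -> : \bigcap_(i in [set` S]) (B i @^-1` [set f i]) = (fun w => [ffun i => B i w]) @^-1`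
  [set f].
  apply/seteqP; split => w /=.
    by move=> h; apply/ffunP => i; rewrite ffunE; exact: h (inS i).
  by move=> <- i _ /=; rewrite ffunE.
rewrite /point_prob => ->.
under eq_bigr => i _ do rewrite (point_probE P (X := B i)) // toe.
rewrite prodEFin /= prodf_div prodr_const card_ord natrX; congr (_ / _).
rewrite inE -natr_prod; congr (_%:R).
have [/forallP h|] := boolP [forall x, f x != x].
  by rewrite big1 // => i _; rewrite h.
rewrite negb_forall => /existsP[x]; rewrite negbK => fx.
by rewrite (bigD1 x) //= fx mul0n.
Qed.

Lemma screaming_toes_measurable (n : nat) d (T : measurableType d) (P : probability T R)
    (B : 'I_n -> T -> 'I_n) (hB : screaming_toes P B) (f : {ffun 'I_n -> 'I_n}) :
  measurable ((fun w => [ffun i => B i w]) @^-1` [set f]).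
Proof.
have [mB _ _] := hB.
have -> : (fun w => [ffun i => B i w]) @^-1` [set f] = \bigcap_(i in [set: 'I_n]) (B i @^-1`
  [set f i]).
  apply/seteqP; split => w /=.
    by move=> <- i _ /=; rewrite ffunE.
  by move=> h; apply/ffunP => i; rewrite ffunE; exact: h.
by apply: fin_bigcap_measurable => // i _; exact: mB.
Qed.

(** The event is a finite disjoint union over maps with counts [m], of which only the
    fixed-point-free ones have positive mass. *)
Lemma screaming_toes_counts_point_prob (p n : nat) d (T : measurableType d) (P : probability T R)
    (B : 'I_n -> T -> 'I_n) (n2 : (2 <= n)%N) (hB : screaming_toes P B) (m : {ffun 'I_p -> nat}) :
  point_prob P (fun w => small_component_counts p (ncomponents (fun k => B k w))) m =
  mean_fpf n (fun c => (small_component_counts p c == m)%:R).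
Proof.
have mBf := screaming_toes_measurable hB.
pose s := [seq f : {ffun 'I_n -> 'I_n} <- enum {ffun 'I_n -> 'I_n} | small_component_counts p
  (ncomponents f) == m].
have us : uniq s by rewrite filter_uniq // enum_uniq.
rewrite {1}/point_prob.
have -> : (fun w => small_component_counts p (ncomponents (fun k => B k w))) @^-1` [set m] =
   (fun w => [ffun i => B i w]) @^-1` [set` s].
  apply/funext => w /=; apply/propext; rewrite mem_filter mem_enum andbT.
  have -> : [ffun i => B i w] = (fun k => B k w) :> (_ -> _) by apply/funext => k; rewrite ffunE.
  by split => [->|/eqP].
rewrite -(sum_point_prob P mBf us) /= big_filter big_enum_cond /=.
under eq_bigr do rewrite (screaming_toes_point_prob n2 hB).
rewrite /mean_fpf /sum_fpf mulr_suml big_mkcond [RHS]big_mkcond /=.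
by apply: eq_bigr => f _; case: ifP; case: ifP; rewrite ?mul0r ?mul1r.
Qed.

End ScreamingToes.

(** * The law of the limiting Poisson vector *)

Section PoissonVector.
Local Open Scope classical_set_scope.
Local Open Scope ring_scope.
Context {R : realType} d (T : measurableType d) (P : probability T R).
Variables (Z : nat -> {RV P >-> nat}) (p : nat).

Definition poisson_vector (w : T) : {ffun 'I_p -> nat} := [ffun i : 'I_p => Z (i + 2)%N w].

Lemma poisson_vector_preimage (m : {ffun 'I_p -> nat}) :
  poisson_vector @^-1` [set m] = \bigcap_(i in [set: 'I_p]) (Z (i + 2)%N @^-1` [set m i]).
Proof.
apply/seteqP; split => w /=.
  by move=> <- i _ /=; rewrite ffunE.
by move=> h; apply/ffunP => i; rewrite ffunE; exact: h.
Qed.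

Lemma poisson_vector_measurable (m : {ffun 'I_p -> nat}) :
  measurable (poisson_vector @^-1` [set m]).
Proof.
rewrite poisson_vector_preimage; apply: fin_bigcap_measurable => // i _.
exact: measurable_funPTI.
Qed.

Lemma poisson_vector_point_prob (m : {ffun 'I_p -> nat})
  (hZindep : mutually_independent P [set j | (2 <= j)%N] measurable
               (fun j => Z j : T -> nat))
  (hZlaw : forall j, (2 <= j)%N ->
     forall A : set nat, distribution P (Z j) A = poisson_law (lambda_tilde R j) A) :
  point_prob P poisson_vector m =
  \prod_(i < p) (lambda_tilde R (i + 2) ^+ m i / (m i)`!%:R * expR (- lambda_tilde R (i + 2))).
Proof.
pose S : {fset nat} := [fset j in [seq (nat_of_ord i + 2)%N | i <- enum 'I_p]]%fset.
(* Independence is indexed by sizes [j] and [m] by ordinals; this gives [[set m i]] at [j = i + 2]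
   and the full set at sizes outside the range. *)
pose E (j : nat) : set nat := [set k | forall i : 'I_p, j = (i + 2)%N -> k = m i].
have EE (i : 'I_p) : E (i + 2)%N = [set m i].
  apply/seteqP; split => k /=; first exact.
  by move=> -> i' /addIn /val_inj ->.
have S2 : [set` S] `<=` [set j | (2 <= j)%N].
  by move=> j /=; rewrite inE /= => /mapP[i _ ->]; rewrite addn2.
have := hZindep S E S2 (fun _ _ => I).
have Spe : perm_eq (enum_fset S) [seq (nat_of_ord i + 2)%N | i <- index_enum 'I_p].
  apply: uniq_perm; rewrite ?fset_uniq ?map_inj_uniq ?index_enum_uniq //.
    by move=> i j /addIn /val_inj.
  move=> j; rewrite inE /=; apply/mapP/mapP => -[i _ ->]; exists i => //.
    by rewrite mem_index_enum.
  by rewrite mem_enum.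
rewrite (perm_big _ Spe) big_map /=.
have -> : \bigcap_(j in [set` S]) (Z j @^-1` E j) = poisson_vector @^-1` [set m].
  rewrite poisson_vector_preimage; apply/seteqP; split => w h.
    move=> i _; rewrite -EE; apply: h => /=.
    by rewrite inE /=; apply/mapP; exists i; rewrite ?mem_enum.
  by move=> j /=; rewrite inE /= => /mapP[i _ ->]; rewrite EE; exact: h.
rewrite /point_prob => ->.
rewrite (eq_bigr (fun i : 'I_p => (lambda_tilde R (i + 2) ^+ m i / (m i)`!%:R * expR (-
  lambda_tilde R (i + 2)))%:E)).
  by rewrite prodEFin.
move=> i _; rewrite EE; have i2 : (2 <= i + 2)%N by rewrite addn2.
have := hZlaw _ i2 [set m i]; rewrite /distribution /pushforward /= => ->.
rewrite /poisson_law /poisson_prob lambda_tilde_gt0 // esum_set1 ?lee_fin ?poisson_pmf_ge0 //.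
by rewrite /poisson_pmf lambda_tilde_gt0.
Qed.

End PoissonVector.

(** * Passage from the point masses to the random row vectors *)

Local Open Scope classical_set_scope.
Local Open Scope ring_scope.

Theorem mainTheorem3 (R : realType)
  (dn : nat -> measure_display) (Omegan : forall n, measurableType (dn n))
  (Pn : forall n, probability (Omegan n) R)
  (B : forall n, 'I_n -> Omegan n -> 'I_n)
  (hB : forall n, (2 <= n)%N -> screaming_toes (Pn n) (@B n))
  (d : measure_display) (Omega : measurableType d) (P : probability Omega R)
  (Z : nat -> {RV P >-> nat})
  (hZindep : mutually_independent P [set j | (2 <= j)%N] measurable
               (fun j => Z j : Omega -> nat))
  (hZlaw : forall j, (2 <= j)%N ->
     forall A : set nat, distribution P (Z j) A = poisson_law (lambda_tilde R j) A)
  (b : nat) (hb : (2 <= b)%N) :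
  cvg_in_distribution Pn
    (fun n w => \row_(i < b - 1)
       (ncomponents (fun k : 'I_n => B n k w) (i + 2))%:R : 'rV[R]_(b - 1))
    P
    (fun w => \row_(i < b - 1) (Z (i + 2)%N w)%:R : 'rV[R]_(b - 1)).
Proof.
(* Both random rows factor through finite functions of counts, so [g \o row_of] is a bounded
   function on a countable type. *)
pose row_of (v : {ffun 'I_(b - 1) -> nat}) : 'rV[R]_(b - 1) := \row_i (v i)%:R.
pose Xn n (w : Omegan n) := small_component_counts (b - 1) (ncomponents (fun k => B n k w)).
have -> : (fun w => \row_(i < b - 1) (Z (i + 2)%N w)%:R) = row_of \o poisson_vector Z (b - 1).
  by apply/funext => w; apply/rowP => i; rewrite !mxE ffunE.
have -> : (fun n w => \row_(i < b - 1) (ncomponents (fun k : 'I_n => B n k w) (i + 2))%:R :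
  'rV[R]_(b - 1)) = fun n => row_of \o Xn n.
  by apply: functional_extensionality_dep => n; apply/funext => w; apply/rowP => i; rewrite
    !mxE ffunE.
move=> g _ bg.
have [M gM] : exists M, forall v, `|g v| <= M.
  have [M [_ hM]] := bg; exists (M + 1) => v.
  by apply: (hM (M + 1)) => //; rewrite ltrDl.
apply: (@cvg_expectation_discrete R _ dn Omegan Pn Xn d Omega P (poisson_vector Z (b - 1)) _
  _ _ (g \o row_of) M).
(* The hypothesis on [B] starts at [n = 2], so measurability is available only from there on. *)
- exists 2%N => // n /= n2 m.
  rewrite (_ : _ @^-1` _ = (fun w => [ffun i => B n i w]) @^-1` [set f : {ffun 'I_n -> 'I_n}
    | small_component_counts (b - 1) (ncomponents f) = m]).
    by apply: measurable_discrete => f; exact: (screaming_toes_measurable (hB n n2)).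
  apply/funext => w /=; rewrite /Xn; congr (small_component_counts _ (ncomponents _) = m).
  by apply/funext => k; rewrite ffunE.
- exact: poisson_vector_measurable.
- move=> m; rewrite poisson_vector_point_prob //.
  apply: cvg_trans; last exact: cvg_mean_small_component_counts.
  apply: near_eq_cvg.
  by exists 2%N => // n /= n2; rewrite screaming_toes_counts_point_prob //; exact: hB.
- by move=> v; exact: gM.
Qed.
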